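(* Let $n\ge3$ and let $A\in\mathbb C^{n\times n}$ be the arrowhead matrix with diagonal entries $a_1,\dots,a_n$, last column $[b_1,\dots,b_{n-1},a_n]^T$, last row $[c_1,\dots,c_{n-1},a_n]$, and all other entries zero. Suppose that $b_j,c_j\ne0$ and $|b_j|=|c_j|$ for all $j=1,\dots,n-1$, and that there is a real $\theta$ such that $\arg b_j+\arg c_j=2\theta+\pi\ (\mathrm{mod}\ 2\pi)$ for all $j=1,\dots,n-1$. Then $k(A)$ equals the sum of the multiplicities of the largest and the smallest eigenvalues of $\operatorname{Re}(e^{-i\theta}A)$.
   Context: For $A\in\mathbb C^{n\times n}$ let $f_A(x)=\langle Ax,x\rangle$ on the unit sphere of $\mathbb C^n$; the numerical range $W(A)$ is the image of $f_A$, and the Gau--Wu number $k(A)$ is the maximal number of orthonormal vectors $x_j\in\mathbb C^n$ with $f_A(x_j)\in\partial W(A)$. $\operatorname{Re}X=(X+X^* )/2$. If the largest and the smallest eigenvalues of $\operatorname{Re}(e^{-i\theta}A)$ coincide, the (single) multiplicity is counted only once. *)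

(* Defs.v *)
From HB Require Import structures.
From mathcomp Require Export all_boot all_order all_algebra.
From mathcomp Require Export complex.
From mathcomp Require Export all_classical all_reals all_analysis.
Export numFieldNormedType.Exports.
Export Order.TTheory GRing.Theory Num.Theory.

Set Implicit Arguments.
Unset Strict Implicit.
Unset Printing Implicit Defensive.

Local Open Scope classical_set_scope.
Local Open Scope sesquilinear_scope.
Local Open Scope complex_scope.
Local Open Scope ring_scope.

Section NumericalRange.
Context {R : realType}.
Local Notation C := R[i].

Definition inner n (x y : 'cV[C]_n) : C := \sum_i x i 0 * (y i 0)^*.

Definition num_form n (A : 'M[C]_n) (x : 'cV[C]_n) : C := inner (A *m x) x.

Definition unit_sphere n : set 'cV[C]_n := [set x | inner x x = 1].

Definition numerical_range n (A : 'M[C]_n) : set C :=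
  num_form A @` @unit_sphere n.

(* [C^o] is [C] with the topology of its norm, the usual one of the plane. *)
Definition boundary (W : set C^o) : set C^o := closure W `\` W°.

Definition orthonormal n m (x : 'I_m -> 'cV[C]_n) : Prop :=
  forall i j, inner (x i) (x j) = (i == j)%:R.

Definition has_boundary_family n (A : 'M[C]_n) (m : nat) : Prop :=
  exists x : 'I_m -> 'cV[C]_n,
    orthonormal x /\ forall j, boundary (numerical_range A) (num_form A (x j)).

(* An orthonormal family in C^n has at most n members, so bounding the index
   by n loses nothing. *)
Definition gau_wu n (A : 'M[C]_n) : nat :=
  \max_(m < n.+1 | `[< has_boundary_family A m >]) m.

Definition re_mx n (X : 'M[C]_n) : 'M[C]_n := 2^-1 *: (X + X^t*).

Definition expi (t : R) : C := cos t +i* sin t.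

(* Principal argument, in ]-pi, pi]; the value at 0 is irrelevant. *)
Definition arg (z : C) : R :=
  let t := acos (complex.Re z / Normc.normc z) in
  if 0 <= complex.Im z then t else - t.

Definition eq_mod_2pi (s t : R) : Prop :=
  exists k : int, s = t + k%:~R * (2 * pi).

(* On [C], [x <= y] means that [y - x] is a nonnegative real; these are meant
   for matrices with real spectrum. *)
Definition largest_eigenvalue n (H : 'M[C]_n) (l : C) : Prop :=
  eigenvalue H l /\ forall m, eigenvalue H m -> m <= l.

Definition smallest_eigenvalue n (H : 'M[C]_n) (l : C) : Prop :=
  eigenvalue H l /\ forall m, eigenvalue H m -> l <= m.

(* Geometric multiplicity, which is also the algebraic one when [H] is
   Hermitian. *)
Definition multiplicity n (H : 'M[C]_n) (l : C) : nat :=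
  \rank (eigenspace H l).

Definition extremal_multiplicity n (H : 'M[C]_n) (lmax lmin : C) : nat :=
  if lmax == lmin then multiplicity H lmax
  else (multiplicity H lmax + multiplicity H lmin)%N.

(* Size n+1.  [unlift ord_max i] is [None] when [i] is the last index and
   [Some k] when [i] is the index k < n. *)
Definition arrowhead n (a : 'I_n.+1 -> C) (b c : 'I_n -> C) : 'M[C]_n.+1 :=
  \matrix_(i, j)
    match unlift ord_max i, unlift ord_max j with
    | None, None => a ord_max
    | Some k, None => b k
    | None, Some k => c k
    | Some _, Some _ => if i == j then a i else 0
    end.

End NumericalRange.

(* Main.v *)
Require Import Defs.
From mathcomp Require Import ring lra.

(** After rotation by [expi (- theta)] the hypotheses on moduli and arguments
say that the off-diagonal entries in the last column and the last row are
opposite conjugates of each other.  Hence [A] rotates to [D - i K], where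
[D = re_mx (expi (- theta) *: A)] is a real diagonal matrix and [K] is a
Hermitian arrowhead matrix whose last column has nonzero off-diagonal entries
[k_j].

Lower bound: for each [i] such that [D i i] is the largest or the smallest
diagonal entry, the [i]-th basis vector is sent to a point of an extremal
supporting line of the numerical range, hence to the boundary
([maximizer_boundary]).  These vectors are counted by the two multiplicities
([rank_eigenspace_diag]).

Upper bound: the numerical range is convex ([numerical_range_convex]), so a
unit vector [x] sent to the boundary is sent to a supporting line
([supporting_line]) and is therefore an eigenvector for the largest eigenvalue
of some combination [p D + q K] ([boundary_eigenvector]).  If [q = 0], then [x]
is supported on the indices of the largest, or of the smallest, entries of [D].
If [q != 0], then the largest eigenvalue exceeds all the diagonal entries but
the last, and solving the rows of the eigenvalue equation gives
[x_j = r_j k_j x_n] with [x_n != 0], where the real numbers [r_j] all have the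
sign of [q] ([skew_arrowhead_extremal], [aligned]).  Two such vectors of the
same sign cannot be orthogonal, so an orthonormal family contains at most two
of them.  Moreover none of their coordinates vanishes.  So as soon as one of
them is present, the members of the family supported on the largest entries of
[D] do not span all the vectors supported there, and one dimension is lost; the
same happens for the smallest entries.  The at most two aligned vectors thus
replace at least two others, and the total never exceeds the sum of the two
multiplicities ([orthonormal_card_le]).  When [D] is scalar, this sum collapses
to the dimension, which bounds any orthonormal family. *)

Set Implicit Arguments.
Unset Strict Implicit.
Unset Printing Implicit Defensive.

Local Open Scope sesquilinear_scope.
Local Open Scope complex_scope.
Local Open Scope ring_scope.

(** * The Hermitian product and the form of a matrix *)

Section Inner.
Context {R : realType}.
Local Notation C := R[i].

Lemma innerDl n (x y z : 'cV[C]_n) : inner (x + y) z = inner x z + inner y z.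
Proof. by rewrite -big_split; apply: eq_bigr => i _; rewrite mxE mulrDl. Qed.

Lemma innerZl n (k : C) (x z : 'cV[C]_n) : inner (k *: x) z = k * inner x z.
Proof. by rewrite mulr_sumr; apply: eq_bigr => i _; rewrite mxE mulrA. Qed.

Lemma inner_conj n (x y : 'cV[C]_n) : (inner x y)^* = inner y x.
Proof.
by rewrite rmorph_sum; apply: eq_bigr => i _; rewrite rmorphM /= conjCK mulrC.
Qed.

Lemma innerDr n (x y z : 'cV[C]_n) : inner z (x + y) = inner z x + inner z y.
Proof. by rewrite -inner_conj innerDl rmorphD /= !inner_conj. Qed.

Lemma innerZr n (k : C) (x z : 'cV[C]_n) : inner z (k *: x) = k^* * inner z x.
Proof. by rewrite -inner_conj innerZl rmorphM /= inner_conj. Qed.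

Lemma inner_ge0 n (x : 'cV[C]_n) : 0 <= inner x x.
Proof. by apply: sumr_ge0 => i _; rewrite -normCK exprn_ge0. Qed.

Lemma inner_eq0 n (x : 'cV[C]_n) : (inner x x == 0) = (x == 0).
Proof.
rewrite psumr_eq0; last by move=> i _; rewrite -normCK exprn_ge0.
apply/allP/eqP => [x0|-> i _]; last by rewrite mxE mul0r eqxx.
apply/matrixP => i j; rewrite ord1 mxE.
by have := x0 i; rewrite mem_index_enum /= mulf_eq0 conjC_eq0 orbb => /(_ isT)/eqP.
Qed.

Lemma inner_gt0 n (x : 'cV[C]_n) : (0 < inner x x) = (x != 0).
Proof. by rewrite lt0r inner_ge0 inner_eq0 andbT. Qed.

Lemma inner_adjoint n (M : 'M[C]_n) (x y : 'cV[C]_n) :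
  inner (M *m x) y = inner x (M^t* *m y).
Proof.
have -> : inner (M *m x) y = \sum_i \sum_j M i j * x j 0 * (y i 0)^*.
  by apply: eq_bigr => i _; rewrite mxE mulr_suml.
rewrite exchange_big; apply: eq_bigr => j _; rewrite mxE rmorph_sum mulr_sumr.
by apply: eq_bigr => i _; rewrite rmorphM /= !mxE conjCK mulrCA mulrA.
Qed.

Lemma num_formZ n (A : 'M[C]_n) (k : C) (x : 'cV[C]_n) :
  num_form A (k *: x) = k * k^* * num_form A x.
Proof. by rewrite /num_form -scalemxAr innerZl innerZr mulrA. Qed.

Lemma num_formD n (A : 'M[C]_n) (x y : 'cV[C]_n) :
  num_form A (x + y) =
  num_form A x + (inner (A *m x) y + inner (A *m y) x) + num_form A y.
Proof. by rewrite /num_form mulmxDr innerDl !innerDr; ring. Qed.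

Lemma num_form_scalar_sub n (A : 'M[C]_n) (l : C) (x : 'cV[C]_n) :
  num_form (A - l%:M) x = num_form A x - l * inner x x.
Proof.
by rewrite /num_form mulmxBl mul_scalar_mx innerDl -scaleN1r !innerZl mulN1r.
Qed.

Lemma exists_unit_multiple n (x : 'cV[C]_n) :
  x != 0 -> exists k : C, [/\ k * k^* * inner x x = 1 & inner (k *: x) (k *: x) = 1].
Proof.
rewrite -inner_gt0 => x_gt0; pose s := sqrtC (inner x x).
have s_gt0 : 0 < s by rewrite sqrtC_gt0.
have sJ : s^-1^* = s^-1 by apply/CrealP; rewrite realV gtr0_real.
suff e : s^-1 * s^-1^* * inner x x = 1.
  by exists s^-1; rewrite innerZl innerZr mulrA.
by rewrite sJ -[inner x x]sqrtCK -/s; field; rewrite gt_eqF.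
Qed.

(** * Convexity of the numerical range *)

(** The form is a real quadratic polynomial in [t] along [w x + t y], once the
factor [w] is chosen to make the cross terms real; its end coefficients have
opposite signs, so it has a real root. *)
Lemma isotropic_vector n (M : 'M[C]_n) (x y : 'cV[C]_n) :
  num_form M x < 0 -> 0 < num_form M y ->
  exists2 u, u != 0 & num_form M u = 0.
Proof.
move=> Mx Mylt.
pose p := inner (M *m x) y; pose q := inner (M *m y) x.
(* the cross terms have the imaginary part of [w * (p - conj q)] *)
have [w w0 wr] : exists2 w : C, w != 0 & w * p + w^* * q \is Num.real.
  have [e|ne] := eqVneq (p - q^*) 0.
    exists 1; first exact: oner_neq0.
    move/eqP: e; rewrite subr_eq0 => /eqP ->.
    by rewrite CrealE rmorphD !rmorphM /= conjCK !rmorph1 !mul1r addrC.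
  exists ((p - q^*)^*); first by rewrite conjC_eq0.
  by apply/CrealP; rewrite !(rmorphD, rmorphM, rmorphN) /= !conjCK; ring.
set g := w * p + w^* * q in wr.
pose c := num_form M (w *: x); pose a := num_form M y.
have c_lt0 : c < 0.
  by rewrite /c num_formZ -normCK pmulr_rlt0 // exprn_gt0 // normr_gt0.
have form t : t \is Num.real ->
    num_form M (w *: x + t *: y) = c + t * g + t ^+ 2 * a.
  move=> /CrealP tJ; rewrite num_formD -/c num_formZ tJ -/a.
  by rewrite -!scalemxAr !innerZl !innerZr -/p -/q tJ /g; ring.
pose s := sqrtC (g ^+ 2 - 4 * a * c).
have sr : s \is Num.real.
  apply: ger0_real; rewrite sqrtC_ge0 subr_ge0.
  apply: (@le_trans _ _ 0); last by rewrite -realEsqr.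
  by rewrite nmulr_lle0 // mulr_ge0 // ltW.
pose t := (s - g) / (2 * a).
have tr : t \is Num.real.
  by rewrite rpred_div ?rpredB // rpredM ?realn // gtr0_real.
exists (w *: x + t *: y).
  apply/eqP => /eqP; rewrite addr_eq0 => /eqP e.
  suff : 0 <= c by rewrite lt_geF.
  rewrite /c e -scaleNr num_formZ -normCK mulr_ge0 ?exprn_ge0 //; exact: ltW.
have a0 : a != 0 by rewrite gt_eqF.
rewrite form //.
have -> : c + t * g + t ^+ 2 * a = (s ^+ 2 - (g ^+ 2 - 4 * a * c)) / (4 * a).
  by rewrite /t; field.
by rewrite sqrtCK subrr mul0r.
Qed.

Definition convex_set (W : set C) : Prop :=
  forall u v (t : R), W u -> W v -> 0 <= t <= 1 -> W (u + t%:C * (v - u)).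

(** The Toeplitz-Hausdorff theorem.  For [z] strictly between two values of the
form, a multiple of [A - z] takes opposite real values at the two vectors. *)
Lemma numerical_range_convex n (A : 'M[C]_n) : convex_set (numerical_range A).
Proof.
move=> _ _ t [x x1 <-] [y y1 <-].
rewrite /unit_sphere/= in x1 y1 *.
have [<- _|ne] := eqVneq (num_form A x) (num_form A y).
  by exists x => //; rewrite subrr mulr0 addr0.
have [->|t0] := eqVneq t 0; first by exists x => //; rewrite mul0r addr0.
have [->|t1] := eqVneq t 1; first by exists y => //; rewrite mul1r addrC subrK.
move=> /andP[t_ge0 t_le1].
pose d := num_form A y - num_form A x; pose z := num_form A x + t%:C * d.
have d0 : d != 0 by rewrite subr_eq0 eq_sym.
pose M := d^-1 *: (A - z%:M).
have formM u : num_form M u = d^-1 * (num_form A u - z * inner u u).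
  by rewrite -num_form_scalar_sub /num_form /M -scalemxAl innerZl.
have [||u u0] := @isotropic_vector _ M x y.
- have -> : num_form M x = - t%:C by rewrite formM x1 /z; field.
  by rewrite oppr_lt0 ltcR lt0r t0.
- have -> : num_form M y = 1 - t%:C.
    by rewrite formM y1 /z -[num_form A y](subrK (num_form A x)) -/d; field.
  by rewrite subr_gt0 ltcR lt_neqAle t1.
rewrite formM => /eqP; rewrite mulf_eq0 invr_eq0 (negbTE d0) subr_eq0 => /eqP e.
have [k [k1 k2]] := exists_unit_multiple u0.
exists (k *: u) => //.
by rewrite num_formZ e mulrCA k1 mulr1.
Qed.

End Inner.

(** * Supporting lines of planar convex sets *)

Section SupportingLine.
Local Open Scope classical_set_scope.
Local Open Scope ring_scope.
Context {R : realType}.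
Local Notation C := R[i].

(** If a point of a convex set can be moved a little in the four axis
directions, the set contains a diamond around it. *)
Lemma convex_interior (W : set C) (z : C) :
  convex_set W -> W z ->
  (forall v : C, v \in [:: 1; -1; 0 +i* 1; 0 -i* 1] ->
     exists2 t : R, 0 < t & W (z + t%:C * v)) ->
  ((W : set C^o)°) z.
Proof.
move=> Wconv Wz cross.
have segment v t s : W (z + t%:C * v) -> 0 < t -> 0 <= s <= t ->
    W (z + s%:C * v).
  move=> Wt t0 /andP[s0 st].
  have -> : z + s%:C * v = z + (s / t)%:C * (z + t%:C * v - z).
    rewrite rmorphM fmorphV /=; field.
    by rewrite fmorph_eq0 gt_eqF.
  by apply: Wconv => //; rewrite ler_pdivrMr // mul1r st divr_ge0 // ltW.
have [e e0 axes] : exists2 e : R, 0 < e & forall v : C,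
    v \in [:: 1; -1; 0 +i* 1; 0 -i* 1] ->
    forall s, 0 <= s <= e -> W (z + s%:C * v).
  move: cross; elim: [:: 1; -1; _; _] => [_|v vs IH cross]; first by exists 1.
  have [|e1 e1_gt0 We1] := IH.
    by move=> w wvs; apply: cross; rewrite inE wvs orbT.
  have [t t_gt0 Wt] := cross v (mem_head _ _).
  exists (Num.min e1 t); first by rewrite lt_min e1_gt0.
  move=> w; rewrite inE => /predU1P[-> s|wvs s]; rewrite le_min => /and3P[s0 se st].
    by apply: (segment v t) => //; rewrite s0.
  by apply: We1 => //; rewrite s0.
apply/nbhs_ballP; exists (e / 2)%:C => /=; first by rewrite ltcR divr_gt0.
move=> w; rewrite -ball_normE /ball_ /= distrC => zw.
have hor : `|complex.Re (w - z)| < e / 2.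
  by rewrite -ltcR; apply: le_lt_trans (normc_ge_Re _) zw.
have ver : `|complex.Im (w - z)| < e / 2.
  rewrite -ltcR; apply: le_lt_trans zw.
  have -> : `|w - z| = `|(w - z) * (0 +i* 1)|.
    by rewrite normrM [X in _ * X]normc_def /= expr0n expr1n add0r sqrtr1 mulr1.
  by rewrite -[complex.Im _]opprK -ReiNIm normrN; apply: normc_ge_Re.
have -> : w = z + (w - z) by rewrite addrC subrK.
case: (w - z) hor ver => x y /= /ltr_normlP[x1 x2] /ltr_normlP[y1 y2].
(* [w] is the midpoint of two points lying on the arms of the cross *)
have Wx : W (z + (2 * x)%:C).
  case: (leP 0 x) => x0.
    have -> : (2 * x)%:C = (2 * x)%:C * 1 by rewrite mulr1.
    by apply: axes; [rewrite !inE eqxx ?orbT | lra].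
  have -> : (2 * x)%:C = (- (2 * x))%:C * -1 by rewrite rmorphN mulrN1 opprK.
  by apply: axes; [rewrite !inE eqxx ?orbT | lra].
have Wy : W (z + (2 * y)%:C * (0 +i* 1)).
  case: (leP 0 y) => y0.
    by apply: axes; [rewrite !inE eqxx ?orbT | lra].
  have -> : (2 * y)%:C * (0 +i* 1) = (- (2 * y))%:C * (0 -i* 1).
    by apply/eqP; rewrite eq_complex /=; apply/andP; split; apply/eqP; ring.
  by apply: axes; [rewrite !inE eqxx ?orbT | lra].
have := Wconv _ _ (2^-1) Wx Wy; rewrite (_ : _ + _ * _ = z + (x +i* y)).
  by apply; lra.
case: (z) => a b.
by apply/eqP; rewrite eq_complex /=; apply/andP; split; apply/eqP; field.
Qed.

(** Scale the vectors of the cone in the open upper and lower half planes to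
imaginary part [1] and [-1].  A real part [s] from above and a real part [t]
from below satisfy [s <= - t], since otherwise a positive multiple of the sum
of the two vectors is [1].  The supremum of the [s] then gives a separating
line; when the cone misses one of the half planes, the real axis is
such a line. *)
Lemma cone_missing_one_half_plane (K : C -> Prop) :
  (forall u v, K u -> K v -> K (u + v)) ->
  (forall u (t : R), 0 < t -> K u -> K (t%:C * u)) ->
  ~ K 1 -> exists2 mu : C, mu != 0 & forall u, K u -> complex.Re (mu * u) <= 0.
Proof.
move=> Kadd Kscale K1.
pose up := [set s : R | K (s +i* 1)]; pose down := [set s : R | K (s -i* 1)].
have up_sub u : K u -> 0 < complex.Im u -> up (complex.Re u / complex.Im u).
  case: u => x y /= Ku y0; rewrite /up /=.
  have -> : x / y +i* 1 = (y^-1)%:C * (x +i* y) :> C.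
    apply/eqP; rewrite eq_complex /=; apply/andP; split; apply/eqP; field; lra.
  by apply: Kscale; rewrite ?invr_gt0.
have down_sub u : K u -> complex.Im u < 0 -> down (complex.Re u / - complex.Im u).
  case: u => x y /= Ku y0; rewrite /down /=.
  have -> : x / - y -i* 1 = ((- y)^-1)%:C * (x +i* y) :> C.
    apply/eqP; rewrite eq_complex /=; apply/andP; split; apply/eqP; field; lra.
  by apply: Kscale; rewrite ?invr_gt0 ?oppr_gt0.
have opposite s t : up s -> down t -> s + t <= 0.
  rewrite /up /down /= => Ks Kt; rewrite leNgt; apply/negP => st; apply: K1.
  have -> : 1 = ((s + t)^-1)%:C * (s +i* 1 + (t -i* 1)) :> C.
    apply/eqP; rewrite eq_complex /=; apply/andP; split; apply/eqP; field; lra.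
  by apply: Kscale; [rewrite invr_gt0 | apply: Kadd].
have [[s0 us0]|noup] := pselect (exists s, up s); last first.
  exists (0 -i* 1) => [|u Ku]; first by rewrite eq_complex /= oppr_eq0 oner_eq0 andbF.
  case: (leP (complex.Im u) 0) => [|/(up_sub _ Ku) us].
    by case: u {Ku} => x y /=; lra.
  by case: noup; eexists; exact: us.
have [[t0 dt0]|nodown] := pselect (exists s, down s); last first.
  exists (0 +i* 1) => [|u Ku]; first by rewrite eq_complex /= oner_eq0 andbF.
  case: (leP 0 (complex.Im u)) => [|/(down_sub _ Ku) us].
    by case: u {Ku} => x y /=; lra.
  by case: nodown; eexists; exact: us.
pose m := sup up.
have ub : has_ubound up by exists (- t0) => s us; have := opposite _ _ us dt0; lra.
have le_m s : up s -> s <= m by move=> us; apply: ub_le_sup.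
have ge_m t : down t -> m <= - t.
  move=> dt; apply: ge_sup; first by exists s0.
  by move=> s us; have := opposite _ _ us dt; lra.
exists (1 +i* m) => [|u Ku]; first by rewrite eq_complex /= oner_eq0.
case: (ltrgtP (complex.Im u) 0) => Imu.
- have := ge_m _ (down_sub _ Ku Imu).
  case: u Imu {Ku} => x y /= y0.
  by rewrite lerNr ler_pdivrMr; lra.
- have := le_m _ (up_sub _ Ku Imu).
  case: u Imu {Ku} => x y /= y0.
  by rewrite ler_pdivrMr; lra.
- case: u Imu Ku => x y /= -> Ku; rewrite mulr0 subr0 mul1r leNgt.
  apply/negP => x0; apply: K1.
  have -> : 1 = (x^-1)%:C * (x +i* 0) :> C.
    apply/eqP; rewrite eq_complex /=; apply/andP; split; apply/eqP; field; lra.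
  by apply: Kscale => //; rewrite invr_gt0.
Qed.

Lemma cone_missing_point_half_plane (K : C -> Prop) (v : C) :
  (forall u v, K u -> K v -> K (u + v)) ->
  (forall u (t : R), 0 < t -> K u -> K (t%:C * u)) ->
  v != 0 -> ~ K v ->
  exists2 mu : C, mu != 0 & forall u, K u -> complex.Re (mu * u) <= 0.
Proof.
move=> Kadd Kscale v0 Kv.
have [||| mu mu0 muK] := @cone_missing_one_half_plane (fun u => K (v * u)).
- by move=> u w Ku Kw; rewrite mulrDr; apply: Kadd.
- by move=> u t t0 Ku; rewrite mulrCA; apply: Kscale.
- by rewrite mulr1.
exists (mu / v) => [|u Ku]; first by rewrite mulf_neq0 ?invr_eq0.
by rewrite -mulrA; apply: muK; rewrite mulrA mulfV // mul1r.
Qed.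

(** Since [z] is not interior, there is an axis direction in which [W] cannot
be entered from [z], so the cone of admissible directions is not the whole
plane. *)
Lemma supporting_line (W : set C) (z : C) :
  convex_set W -> W z -> ~ ((W : set C^o)°) z ->
  exists2 mu : C, mu != 0 & forall w, W w -> complex.Re (mu * (w - z)) <= 0.
Proof.
move=> Wconv Wz nint.
pose K u := exists2 t : R, 0 < t & W (z + t%:C * u).
have [v vin Kv] : exists2 v, v \in [:: 1; -1; 0 +i* 1; 0 -i* 1] & ~ K v.
  apply: contrapT => nex; apply: nint; apply: convex_interior => // v vin.
  by apply: contrapT => Kv; apply: nex; exists v.
have v0 : v != 0.
  move: vin; rewrite !inE => /or4P[]/eqP->; rewrite eq_complex /=;
  by rewrite ?oppr_eq0 oner_eq0 ?andbF.
have [|| mu mu0 muK] := @cone_missing_point_half_plane K v _ _ v0 Kv.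
- move=> u1 u2 [t1 t1_gt0 W1] [t2 t2_gt0 W2].
  have t12 : 0 < t1 + t2 by lra.
  exists (t1 * t2 / (t1 + t2)); first by rewrite divr_gt0 ?mulr_gt0.
  have -> : z + (t1 * t2 / (t1 + t2))%:C * (u1 + u2) =
      z + t1%:C * u1 + (t1 / (t1 + t2))%:C * (z + t2%:C * u2 - (z + t1%:C * u1)).
    rewrite !rmorphM !fmorphV rmorphD /=; field.
    by rewrite -rmorphD fmorph_eq0 gt_eqF.
  apply: Wconv => //; rewrite ler_pdivrMr // mul1r lerDl (ltW t2_gt0) andbT.
  by rewrite divr_ge0 // ltW.
- move=> u t t0 [s s0 Ws]; exists (s / t); first by rewrite divr_gt0.
  rewrite mulrA -rmorphM /= (_ : s / t * t = s) //; field; lra.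
exists mu => // w Ww; apply: muK; exists 1 => //.
by rewrite mul1r addrC subrK.
Qed.

End SupportingLine.

(** * Boundary points of the numerical range *)

Section NumericalRangeBoundary.
Local Open Scope classical_set_scope.
Local Open Scope ring_scope.
Context {R : realType}.
Local Notation C := R[i].

Lemma num_form_re_mx n (X : 'M[C]_n) (y : 'cV[C]_n) :
  num_form (re_mx X) y = (complex.Re (num_form X y))%:C.
Proof.
rewrite ReJ_add /num_form /re_mx -scalemxAl innerZl mulmxDl innerDl.
rewrite -[inner (X ^t* *m y) y]inner_conj -inner_adjoint mulrC.
by [].
Qed.

Lemma re_mx_hermitian n (X : 'M[C]_n) : (re_mx X)^t* = re_mx X.
Proof.
apply/matrixP => i j; rewrite !mxE rmorphM rmorphD /= conjCK addrC.
by rewrite fmorphV rmorph_nat.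
Qed.

(** Otherwise the form would become negative when moving from [x] a small
distance in the direction [- P x]. *)
Lemma psd_isotropic_kernel n (P : 'M[C]_n) (x : 'cV[C]_n) :
  P^t* = P -> (forall y, 0 <= num_form P y) -> num_form P x = 0 -> P *m x = 0.
Proof.
move=> Ph Ppos Px; apply/eqP; apply: contrapT => /negP.
set y := P *m x; rewrite -inner_gt0; set N := inner y y => N0.
set q := num_form P y; have q0 : 0 <= q := Ppos y.
have qN : 0 < q + N by rewrite ltr_wpDl.
(* of the order of the minimizer [N / q], but defined when [q = 0] *)
pose e := N / (q + N).
have eJ : e^* = e.
  by apply/CrealP; rewrite rpred_div // ger0_real // ltW.
have Pyx : inner (P *m y) x = N by rewrite inner_adjoint Ph.
have := Ppos (x + (- e) *: y).
rewrite num_formD num_formZ Px -/q -scalemxAr innerZl innerZr -/y -/N Pyx.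
rewrite rmorphN /= eJ.
have -> : 0 + (- e * N + - e * N) + - e * - e * q =
    - (N ^+ 2 * (q + N + N) / (q + N) ^+ 2).
  by rewrite /e; field; rewrite gt_eqF.
rewrite oppr_ge0 => /le_gtF; rewrite divr_gt0 ?mulr_gt0 ?exprn_gt0 //.
by rewrite addr_gt0.
Qed.

(** A supporting line at [num_form A x] with normal [mu] says that [x]
maximizes the form of [re_mx (mu *: A)], so that [x] is an eigenvector for the
largest eigenvalue [l] of that matrix. *)
Lemma boundary_eigenvector n (A : 'M[C]_n) (x : 'cV[C]_n) :
  inner x x = 1 -> boundary (numerical_range A) (num_form A x) ->
  exists (mu : C) (l : R), let P := l%:C%:M - re_mx (mu *: A) in
    [/\ mu != 0, P *m x = 0, P^t* = P & forall y, 0 <= num_form P y].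
Proof.
move=> x1 [_ nint].
have Wx : numerical_range A (num_form A x) by exists x.
have [mu mu0 mule] := supporting_line (@numerical_range_convex _ _ A) Wx nint.
pose l := complex.Re (mu * num_form A x); exists mu, l => P.
have formP y : num_form P y = l%:C * inner y y - (complex.Re (mu * num_form A y))%:C.
  rewrite /P -opprB /num_form mulNmx -scaleN1r innerZl mulN1r.
  rewrite -/(num_form (re_mx (mu *: A) - l%:C%:M) y) num_form_scalar_sub opprB.
  by rewrite num_form_re_mx /num_form -scalemxAl innerZl.
have Ppos y : 0 <= num_form P y.
  have [->|y0] := eqVneq y 0.
    by rewrite /num_form mulmx0 /inner big1 // => i _; rewrite mxE mul0r.
  have [k [k1 k2]] := exists_unit_multiple y0.
  have : 0 <= num_form P (k *: y).
    rewrite formP k2 mulr1 subr_ge0 lecR.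
    have := mule _ (ex_intro2 _ _ (k *: y) k2 erefl).
    by rewrite mulrBr raddfB /= subr_le0.
  rewrite num_formZ -normCK pmulr_rge0 // exprn_gt0 // normr_gt0.
  by apply: contra_eq_neq k1 => ->; rewrite !mul0r eq_sym oner_neq0.
have Ph : P^t* = P.
  rewrite /P; move: (re_mx_hermitian (mu *: A)); set H := re_mx _ => Hh.
  rewrite -[in RHS]Hh; apply/matrixP => i j; rewrite !mxE rmorphB rmorphMn /=.
  by rewrite eq_sym [(l%:C)^*]conjc_real.
split=> //; apply: psd_isotropic_kernel => //.
by rewrite formP x1 mulr1 subrr.
Qed.

(** The points obtained from [num_form A x] by moving along the outer normal
lie outside the range. *)
Lemma maximizer_boundary n (A : 'M[C]_n) (x : 'cV[C]_n) (mu : C) :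
  mu != 0 -> inner x x = 1 ->
  (forall y, inner y y = 1 ->
     complex.Re (mu * num_form A y) <= complex.Re (mu * num_form A x)) ->
  boundary (numerical_range A) (num_form A x).
Proof.
move=> mu0 x1 xmax; split; first by apply: subset_closure; exists x.
move=> /nbhs_ballP[e /= e0 ball_sub].
pose z := num_form A x; pose d := e / 2 * (`|mu| / mu).
have [|y y1 yz] := ball_sub (z + d).
  rewrite -ball_normE /ball_ /= opprD addNKr normrN /d normrM.
  rewrite [`|_ / mu|]normrM normr_id normfV mulfV ?normr_eq0 // mulr1 gtr0_norm ?divr_gt0 //.
  by rewrite ltr_pdivrMr // ltr_pMr // ltr1n.
have := xmax _ y1; rewrite yz mulrDr raddfD /= gerDl.
rewrite /d mulrCA [mu * _]mulrC divfK // leNgt => /negP; apply.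
by rewrite -ltcR RRe_real ?gtr0_real // mulr_gt0 ?divr_gt0 // normr_gt0.
Qed.

End NumericalRangeBoundary.

(** * Polar form *)

Section Polar.
Context {R : realType}.
Local Notation C := R[i].

Lemma expiD (s t : R) : expi (s + t) = expi s * expi t.
Proof.
apply/eqP; rewrite eq_complex /= cosD sinD eqxx /=.
by apply/eqP; ring.
Qed.

Lemma conj_expi (t : R) : (expi t)^* = expi (- t).
Proof. by rewrite /expi cosN sinN. Qed.

Lemma expi0 : expi (0 : R) = 1.
Proof. by rewrite /expi cos0 sin0. Qed.

Lemma expi_neq0 (t : R) : expi t != 0.
Proof.
apply/eqP => t0; have := expiD t (- t); rewrite subrr expi0 t0 mul0r => /eqP.
by rewrite oner_eq0.
Qed.

Lemma expi_period (k : int) : expi (k%:~R * (2 * pi)) = 1 :> C.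
Proof.
have nat_period n : expi (n%:R * (2 * pi)) = 1 :> C.
  elim: n => [|n IHn]; first by rewrite mul0r expi0.
  rewrite -natr1 mulrDl expiD IHn !mul1r mulr_natl /expi cos2pi.
  by rewrite mulr2n sinDpi sinpi oppr0.
case: k => n; first by rewrite -pmulrn nat_period.
rewrite NegzE mulrNz mulNr -conj_expi -pmulrn nat_period; exact: rmorph1.
Qed.

Lemma expi_pi : expi pi = -1 :> C.
Proof. by apply/eqP; rewrite eq_complex /= cospi sinpi oppr0 !eqxx. Qed.

Lemma polar_form (z : C) : z != 0 -> z = `|z| * expi (arg z).
Proof.
move=> z0; set r := Normc.normc z.
have -> : `|z| = r%:C by rewrite normc_def /r; case: (z).
have r0 : 0 < r by rewrite -ltcR; move: z0; rewrite -normr_gt0 normc_def /r; case: (z).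
have r2 : r ^+ 2 = complex.Re z ^+ 2 + complex.Im z ^+ 2.
  by rewrite /r; case: (z) => x y /=; rewrite sqr_sqrtr // addr_ge0 // sqr_ge0.
rewrite /arg -/r; set u := complex.Re z / r; set v := complex.Im z / r.
have uv : 1 - u ^+ 2 = v ^+ 2.
  rewrite /u /v !expr_div_n.
  have -> : complex.Im z ^+ 2 = r ^+ 2 - complex.Re z ^+ 2 by rewrite r2; ring.
  field; lra.
have ur : -1 <= u <= 1.
  by have := sqr_ge0 v; rewrite -uv => u2; apply/andP; split; nra.
suff : expi (if 0 <= complex.Im z then acos u else - acos u) = u +i* v.
  move=> ->; rewrite /u /v; case: (z) => x y.
  by apply/eqP; rewrite eq_complex /=; apply/andP; split; apply/eqP; field; lra.
case: ifP => y0; rewrite /expi ?cosN ?sinN acosK // sin_acos // uv sqrtr_sqr.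
  by rewrite ger0_norm // divr_ge0 // ltW.
rewrite ler0_norm ?opprK //.
by rewrite /v pmulr_lle0 ?invr_gt0 //; lra.
Qed.

(** The two sides have the same modulus, and their arguments
[theta - arg c] and [arg b - theta + pi] agree modulo [2 * pi]. *)
Lemma skew_phase (b c : C) (theta : R) :
  b != 0 -> c != 0 -> `|b| = `|c| ->
  eq_mod_2pi (arg b + arg c) (2 * theta + pi) ->
  (expi (- theta) * c)^* = - (expi (- theta) * b).
Proof.
move=> b0 c0 bc [k e].
have /(congr1 (@expi R)) := e.
rewrite (expiD (arg b)) (expiD (_ + pi)) (expiD (2 * theta)) expi_period expi_pi.
rewrite mulr1 mulr_natl mulr2n expiD mulrN1 => ebc.
rewrite [in LHS](polar_form c0) [in RHS](polar_form b0) -bc.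
rewrite !rmorphM /= !conj_expi opprK.
have rJ : (`|b|)^* = `|b| by apply/CrealP; rewrite normr_real.
have inv t : expi (- t) = (expi t)^-1 :> C.
  by apply: (mulfI (expi_neq0 t)); rewrite -expiD subrr expi0 mulfV ?expi_neq0.
rewrite rJ !inv.
have -> : expi (arg b) = - (expi theta * expi theta) / expi (arg c).
  by rewrite -ebc mulfK // expi_neq0.
by field; rewrite !expi_neq0.
Qed.

End Polar.

(** * Eigenvalues of diagonal matrices *)

Lemma eigenvalue_diag (F : fieldType) n (D : 'M[F]_n) (l : F) :
  is_diag_mx D -> reflect (exists i, D i i = l) (eigenvalue D l).
Proof.
move=> /is_diag_mxP diagD; apply: (iffP eigenvalueP) => [[v vD v0]|[i <-]].
  have /rV0Pn[i vi] := v0; exists i.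
  move/matrixP/(_ 0 i): vD; rewrite !mxE (bigD1 i) //= big1 ?addr0.
    by rewrite mulrC; exact: mulIf.
  by move=> j ji; rewrite diagD ?mulr0.
exists (delta_mx 0 i).
  rewrite -rowE; apply/matrixP => j k; rewrite !mxE ord1 eqxx /=.
  by have [->|ki] := eqVneq k i; rewrite ?mulr1 ?mulr0 // diagD // eq_sym.
by apply/rV0Pn; exists i; rewrite mxE !eqxx oner_neq0.
Qed.

Lemma rank_eigenspace_diag (F : fieldType) n (D : 'M[F]_n) (l : F) :
  is_diag_mx D -> \rank (eigenspace D l) = #|[set i | D i i == l]|.
Proof.
move=> /is_diag_mxP diagD; set I := [set i | _].
(* a basis of the eigenspace, as rows *)
pose E : 'M[F]_(#|I|, n) := \matrix_(s, i) (enum_val s == i)%:R.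
have EE : E *m E^T = 1%:M.
  apply/matrixP => s t; rewrite !mxE (bigD1 (enum_val t)) //= big1.
    by rewrite !mxE eqxx mulr1 addr0 (inj_eq enum_val_inj).
  by move=> i it; rewrite !mxE [enum_val t == i]eq_sym (negbTE it) mulr0.
have <- : \rank E = #|I| by apply/eqP/row_freeP; exists E^T.
apply/eqP; rewrite eqn_leq; apply/andP; split; apply: mxrankS.
  have : eigenspace D l *m D = l *: eigenspace D l by apply/eigenspaceP.
  move: (eigenspace D l) => V VD; suff -> : V = V *m E^T *m E by apply: submxMl.
  apply/matrixP => r j; rewrite -mulmxA [RHS]mxE (bigD1 j) //= big1 ?addr0.
    have [jI|jI] := boolP (j \in I).
      rewrite !mxE (bigD1 (enum_rank_in jI j)) //= big1 ?addr0.
        by rewrite !mxE enum_rankK_in // eqxx !mulr1.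
      move=> s sj; rewrite !mxE; case: eqP => [e|]; last by rewrite mulr0.
      by case/eqP: sj; apply: enum_val_inj; rewrite enum_rankK_in.
    suff -> : V r j = 0 by rewrite mul0r.
    move/matrixP/(_ r j): VD; rewrite !mxE (bigD1 j) //= big1 ?addr0; last first.
      by move=> k kj; rewrite diagD ?mulr0.
    move/eqP; rewrite mulrC -subr_eq0 -mulrBl mulf_eq0 subr_eq0.
    by move: jI; rewrite inE => /negbTE ->; move/eqP.
  move=> k kj; rewrite !mxE big1 ?mulr0 // => s _; rewrite !mxE.
  have [e1|] := eqVneq (enum_val s) k; last by rewrite mul0r.
  by rewrite e1 (negbTE kj) mulr0.
apply/eigenspaceP/matrixP => s j; rewrite !mxE (bigD1 (enum_val s)) //= big1.
  rewrite !mxE eqxx mul1r addr0; have [<-|ne] := eqVneq; last by rewrite diagD // mulr0.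
  by have := enum_valP s; rewrite inE => /eqP ->; rewrite mulr1.
by move=> i is_; rewrite !mxE eq_sym (negbTE is_) mul0r.
Qed.

(** * Orthogonal families *)

Section Orthogonal.
Context {R : realType}.
Local Notation C := R[i].

Lemma inner_delta n (x : 'cV[C]_n) (i : 'I_n) : inner x (delta_mx i 0) = x i 0.
Proof.
rewrite /inner (bigD1 i) //= big1 ?addr0.
  by rewrite mxE !eqxx rmorph1 mulr1.
by move=> j ji; rewrite mxE (negbTE ji) rmorph0 mulr0.
Qed.

Lemma num_form_delta n (A : 'M[C]_n) (i : 'I_n) :
  num_form A (delta_mx i 0) = A i i.
Proof. by rewrite /num_form inner_delta -colE mxE. Qed.

Definition supported n (I : {set 'I_n}) (x : 'cV[C]_n) : Prop :=
  forall i, x i 0 != 0 -> i \in I.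

Lemma inner_supported n (I : {set 'I_n}) (x y : 'cV[C]_n) :
  supported I x -> inner x y = \sum_(i in I) x i 0 * (y i 0)^*.
Proof.
move=> xI; rewrite /inner [RHS]big_mkcond; apply: eq_bigr => i _.
case: ifP => // iI; suff /eqP -> : x i 0 == 0 by rewrite mul0r.
by apply/negPn/negP => /xI; rewrite iI.
Qed.

(** The matrix of the coordinates in [I] has a right inverse, its adjoint with
normalized columns. *)
Lemma orthogonal_card n (T : finType) (x : T -> 'cV[C]_n) (I : {set 'I_n}) :
  (forall s t, s != t -> inner (x s) (x t) = 0) ->
  (forall s, x s != 0) -> (forall s, supported I (x s)) -> (#|T| <= #|I|)%N.
Proof.
move=> orth x0 xI.
pose M : 'M[C]_(#|T|, #|I|) := \matrix_(s, i) x (enum_val s) (enum_val i) 0.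
pose N : 'M[C]_(#|I|, #|T|) := \matrix_(i, t)
  ((x (enum_val t) (enum_val i) 0)^* / inner (x (enum_val t)) (x (enum_val t))).
apply: (@mulmx1_min _ _ _ M N); apply/matrixP => s t; rewrite !mxE.
under eq_bigr do rewrite !mxE mulrA.
rewrite -mulr_suml -(big_enum_val (fun i => x (enum_val s) i 0 * (x (enum_val t) i 0)^*)).
rewrite -inner_supported //; have [->|st] := eqVneq s t.
  by rewrite mulfV ?inner_eq0.
by rewrite orth ?mul0r // (inj_eq enum_val_inj).
Qed.

(** The restriction of [w] to [I] extends the family, and remains orthogonal
to it because the members of the family vanish outside [I]. *)
Lemma orthogonal_card_lt n (T : finType) (x : T -> 'cV[C]_n) (I : {set 'I_n})
    (w : 'cV[C]_n) :
  (forall s t, s != t -> inner (x s) (x t) = 0) ->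
  (forall s, x s != 0) -> (forall s, supported I (x s)) ->
  (forall s, inner (x s) w = 0) -> (exists2 i, i \in I & w i 0 != 0) ->
  (#|T| < #|I|)%N.
Proof.
move=> orth x0 xI xw [i iI wi]; rewrite -card_option.
pose wI : 'cV[C]_n := \col_i (if i \in I then w i 0 else 0).
have xwI s : inner (x s) wI = 0.
  rewrite -[RHS](xw s) !(inner_supported _ (xI s)).
  by apply: eq_bigr => j jI; rewrite mxE jI.
apply: (@orthogonal_card _ _ (oapp x wI)) => [[s|] [t|] //= st|[s|]|[s|]] //=.
- exact: orth.
- by rewrite -inner_conj xwI rmorph0.
- by apply/eqP => /matrixP/(_ i 0)/eqP; rewrite !mxE iI (negbTE wi).
- by move=> j; rewrite mxE; case: ifP => //; rewrite eqxx.
Qed.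

End Orthogonal.

(** * Skew-Hermitian coupling in arrowhead matrices *)

Lemma re_mxZE (R : realType) n (nu : R[i]) (X : 'M[R[i]]_n) i j :
  re_mx (nu *: X) i j = 2^-1 * (nu * X i j + (nu * X j i)^*).
Proof. by rewrite !mxE. Qed.

Section Arrowhead.
Context {R : realType} {n : nat}.
Local Notation C := R[i].
Implicit Types (x y : 'cV[C]_n.+1) (k : 'I_n -> C).

(** This is the shape of the eigenvectors for the largest eigenvalue of a
Hermitian arrowhead matrix whose last column is [q k_j] off the diagonal, where
[q] is a real number of the sign of [s] and no [k_j] vanishes. *)
Definition aligned (s : R) k x : Prop :=
  x ord_max 0 != 0 /\
  forall j, exists2 r : R, 0 < s * r &
    x (lift ord_max j) 0 = r%:C * k j * x ord_max 0.

Lemma aligned_neq0 (s : R) k x i :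
  (forall j, k j != 0) -> aligned s k x -> x i 0 != 0.
Proof.
move=> k0 [xn xj]; have [j ->|->//] := unliftP ord_max i.
have [r sr ->] := xj j; rewrite !mulf_neq0 //.
by rewrite fmorph_eq0; apply: contraTneq sr => ->; rewrite mulr0 ltxx.
Qed.

(** Divided by its last term, the sum defining the product has nonnegative
terms. *)
Lemma aligned_inner_neq0 (s : R) k x y :
  aligned s k x -> aligned s k y -> inner x y != 0.
Proof.
move=> [xn xj] [yn yj]; pose z := x ord_max 0 * (y ord_max 0)^*.
have z0 : z != 0 by rewrite mulf_neq0 // conjC_eq0.
have -> : inner x y = z * \sum_i (x i 0 * (y i 0)^* / z).
  by rewrite -mulr_suml mulrC divfK.
rewrite mulf_neq0 // psumr_eq0 => [|i _].
  apply/negP => /allP /(_ ord_max (mem_index_enum _)).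
  by rewrite /= divff // oner_eq0.
have [j ->|->] := unliftP ord_max i; last by rewrite divff // ler01.
have [r sr ->] := xj j; have [t st ->] := yj j.
rewrite !rmorphM /= [(t%:C)^*]conjc_real.
have -> : r%:C * k j * x ord_max 0 * (t%:C * (k j)^* * (y ord_max 0)^*) / z =
    (r * t)%:C * (k j * (k j)^*).
  by rewrite rmorphM /z /=; field; rewrite conjC_eq0 xn yn.
rewrite -normCK mulr_ge0 ?exprn_ge0 // ler0c.
suff : 0 < r * t by exact: ltW.
have : 0 < (s * r) * (s * t) by rewrite mulr_gt0.
by rewrite mulrACA pmulr_rgt0 // -expr2 exprn_even_gt0 //=;
  apply: contraTneq sr => ->; rewrite mul0r ltxx.
Qed.

Context (a : 'I_n.+1 -> C) (b c : 'I_n -> C).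
Let B := arrowhead a b c.

Lemma arrowhead_diag i : B i i = a i.
Proof.
by rewrite mxE; case: unliftP => [j _|->]; rewrite ?eqxx.
Qed.

Lemma arrowhead_last j : B (lift ord_max j) ord_max = b j.
Proof. by rewrite mxE liftK unlift_none. Qed.

Lemma arrowhead_last_row j : B ord_max (lift ord_max j) = c j.
Proof. by rewrite mxE liftK unlift_none. Qed.

Lemma arrowhead_inner i j : i != j -> B (lift ord_max i) (lift ord_max j) = 0.
Proof. by move=> ij; rewrite mxE !liftK (inj_eq lift_inj) (negbTE ij). Qed.

Context (skew : forall j, (c j)^* = - b j).

Lemma re_mx_diag (nu : C) i :
  re_mx (nu *: B) i i = (complex.Re (nu * a i))%:C.
Proof. by rewrite re_mxZE arrowhead_diag ReJ_add mulrC. Qed.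

Lemma re_mx_inner (nu : C) i j :
  i != j -> re_mx (nu *: B) (lift ord_max i) (lift ord_max j) = 0.
Proof.
move=> ij; rewrite re_mxZE arrowhead_inner // arrowhead_inner 1?eq_sym //.
by rewrite mulr0 rmorph0 addr0 mulr0.
Qed.

(** The skewness makes the coupling of [B] disappear from the real part, and
only the imaginary part of [nu] brings it back. *)
Lemma re_mx_last (nu : C) j :
  re_mx (nu *: B) (lift ord_max j) ord_max = (complex.Im nu)%:C * ((0 +i* 1) * b j).
Proof.
rewrite re_mxZE arrowhead_last arrowhead_last_row rmorphM /= skew.
have -> : nu * b j + nu^* * - b j = (nu - nu^*) * b j by ring.
by rewrite [nu - _]subcJ; field.
Qed.

Lemma re_mx_arrowhead_diag : is_diag_mx (re_mx B).
Proof.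
have E i : re_mx B (lift ord_max i) ord_max = 0.
  by rewrite -[B]scale1r re_mx_last mul0r.
apply/is_diag_mxP => i j ij.
have [i' ei|ei] := unliftP ord_max i; have [j' ej|ej] := unliftP ord_max j; subst.
- by rewrite -[B]scale1r re_mx_inner //; apply: contraNneq ij => ->.
- exact: E.
- by rewrite -re_mx_hermitian mxE mxE E rmorph0.
- by rewrite eqxx in ij.
Qed.

(** If [nu] is real, [l] is the largest entry of a nonzero real multiple of the
diagonal matrix [re_mx B].  Otherwise the off-diagonal entries of the last
column are nonzero, so that positivity forces [l] to exceed all the diagonal
entries but the last, and each row but the last of the eigenvalue equation
expresses a coordinate of [x] by the last one, with a factor of the sign of
[complex.Im nu]. *)
Lemma skew_arrowhead_extremal (nu : C) (l : R) x :
  (forall j, b j != 0) -> nu != 0 -> x != 0 ->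
  let P := l%:C%:M - re_mx (nu *: B) in
  P *m x = 0 -> P^t* = P -> (forall y, 0 <= num_form P y) ->
  [\/ forall i, x i 0 != 0 -> forall j, re_mx B j j <= re_mx B i i,
      forall i, x i 0 != 0 -> forall j, re_mx B i i <= re_mx B j j,
      aligned 1 (fun j => (0 +i* 1) * b j) x |
      aligned (-1) (fun j => (0 +i* 1) * b j) x].
Proof.
move=> b0 nu0 x0 P Px Ph Ppos; pose k j := (0 +i* 1) * b j.
have k0 j : k j != 0 by rewrite mulf_neq0 // eq_complex /= oner_eq0 andbF.
have Pdiag i : P i i = (l - complex.Re (nu * a i))%:C.
  by rewrite 2!mxE [in X in _ + X]mxE re_mx_diag eqxx rmorphB.
have Pii i : complex.Re (nu * a i) <= l.
  by have := Ppos (delta_mx i 0); rewrite num_form_delta Pdiag ler0c subr_ge0.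
pose q := complex.Im nu.
have Plast j : P (lift ord_max j) ord_max = - (q%:C * k j).
  rewrite 2!mxE [in X in _ + X]mxE re_mx_last -/q -/(k j).
  by rewrite eq_sym (negbTE (neq_lift _ _)) add0r.
have Pinner i j : i != j -> P (lift ord_max i) (lift ord_max j) = 0.
  move=> ij; rewrite 2!mxE [in X in _ + X]mxE re_mx_inner //.
  by rewrite (inj_eq lift_inj) (negbTE ij) subr0.
have row j : P (lift ord_max j) (lift ord_max j) * x (lift ord_max j) 0 =
    q%:C * k j * x ord_max 0.
  move/matrixP/(_ (lift ord_max j) 0): Px; rewrite mxE [RHS]mxE.
  rewrite (bigD1 (lift ord_max j)) //= (bigD1 ord_max) ?neq_lift //= big1.
    by rewrite Plast addr0 mulNr => /eqP; rewrite subr_eq0 => /eqP.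
  move=> i /andP[ij il]; have [i' ei|ei] := unliftP ord_max i.
    by rewrite ei Pinner ?mul0r //; apply: contraNneq ij => e; rewrite ei e.
  by rewrite ei eqxx in il.
have [q0|q0] := eqVneq q 0.
  have Da i : re_mx B i i = (complex.Re (a i))%:C.
    by rewrite -[B]scale1r re_mx_diag mul1r.
  have Ra i : complex.Re (nu * a i) = complex.Re nu * complex.Re (a i).
    move: q0; rewrite /q; case: (nu) (a i) => p q' [u v] /= ->.
    by rewrite mul0r subr0.
  have p0 : complex.Re nu != 0.
    by move: nu0; rewrite eq_complex /= -/q q0 eqxx andbT.
  have top i : x i 0 != 0 -> l = complex.Re nu * complex.Re (a i).
    move=> xi; apply/eqP; rewrite -subr_eq0 -Ra.
    have : P i i * x i 0 = 0.
      move/matrixP/(_ i 0): Px; rewrite mxE [RHS]mxE (bigD1 i) //= big1 ?addr0 //.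
      move=> j ji; suff -> : P i j = 0 by rewrite mul0r.
      rewrite 2!mxE [in X in _ + X]mxE eq_sym (negbTE ji) sub0r.
      have [j' ej|ej] := unliftP ord_max j; have [i' ei|ei] := unliftP ord_max i; subst.
      - by rewrite re_mx_inner ?oppr0 //; apply: contraNneq ji => ->.
      - by rewrite -re_mx_hermitian mxE mxE re_mx_last -/q q0 mul0r rmorph0 oppr0.
      - by rewrite re_mx_last -/q q0 mul0r oppr0.
      - by rewrite eqxx in ji.
    by move/eqP; rewrite mulf_eq0 (negbTE xi) orbF Pdiag fmorph_eq0.
  case: (ltrgtP (complex.Re nu) 0) p0 => // p0 _; [apply: Or42|apply: Or41] => i xi j.
    by rewrite !Da lecR -(ler_nM2l p0) -Ra -(top i).
  by rewrite !Da lecR -(ler_pM2l p0) -Ra -(top i).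
have Pjj j : 0 < l - complex.Re (nu * a (lift ord_max j)).
  rewrite lt0r subr_ge0 Pii andbT; apply/negP => /eqP z.
  have : P *m (delta_mx (lift ord_max j) 0 : 'cV[C]_n.+1) = 0.
    by apply: psd_isotropic_kernel => //; rewrite num_form_delta Pdiag z.
  move/matrixP/(_ ord_max 0); rewrite -colE [LHS]mxE [RHS]mxE.
  rewrite -Ph [LHS]mxE [X in X^*]mxE Plast => /eqP.
  by rewrite conjC_eq0 oppr_eq0 mulf_eq0 (negbTE (k0 j)) fmorph_eq0 (negbTE q0).
have coord j : x (lift ord_max j) 0 =
    (q / (l - complex.Re (nu * a (lift ord_max j))))%:C * k j * x ord_max 0.
  have P0 : P (lift ord_max j) (lift ord_max j) != 0.
    by rewrite Pdiag fmorph_eq0 gt_eqF.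
  by apply: (mulfI P0); rewrite row rmorphM fmorphV /= -Pdiag; field.
have xn : x ord_max 0 != 0.
  apply: contraNneq x0 => xn; apply/eqP/matrixP => i i0; rewrite ord1 mxE.
  by have [j ->|->//] := unliftP ord_max i; rewrite coord xn mulr0.
case: (ltrgtP q 0) q0 => // q0 _; [apply: Or44|apply: Or43]; split => // j.
  by eexists; [|exact: coord]; rewrite mulN1r -mulNr divr_gt0 // oppr_gt0.
by eexists; [|exact: coord]; rewrite mul1r divr_gt0.
Qed.

End Arrowhead.

(** * Counting *)

Section Counting.
Context {R : realType} {n : nat}.
Local Notation C := R[i].

Lemma aligned_card m (x : 'I_m -> 'cV[C]_n.+1) (s : R) (k : 'I_n -> C) :
  orthonormal x -> (#|[set j | `[< aligned s k (x j) >]]| <= 1)%N.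
Proof.
move=> orth; apply/card_le1_eqP => i j; rewrite !inE => xi xj.
apply/eqP; apply: contraT => ij.
by have := aligned_inner_neq0 xj xi; rewrite orth (negbTE ij) eqxx.
Qed.

(** The presence of an aligned member costs one dimension in each of the two
coordinate subspaces, and there are at most two aligned members, one of each
sign. *)
Lemma orthonormal_card_le m (x : 'I_m -> 'cV[C]_n.+1) (I1 I2 : {set 'I_n.+1})
    (k : 'I_n -> C) :
  orthonormal x -> (forall j, k j != 0) -> (0 < #|I1|)%N -> (0 < #|I2|)%N ->
  (forall j, [\/ supported I1 (x j), supported I2 (x j),
                 aligned 1 k (x j) | aligned (-1) k (x j)]) ->
  (m <= #|I1| + #|I2|)%N.
Proof.
move=> orth k0 I1_gt0 I2_gt0 kinds.
pose S s := [set j | `[< aligned s k (x j) >]]; pose T := S 1 :|: S (-1).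
pose U (I : {set 'I_n.+1}) := [set j | `[< supported I (x j) >]] :\: T.
have cover : (m <= #|T| + (#|U I1| + #|U I2|))%N.
  apply: leq_trans (leq_add (leqnn _) (leq_card_setU _ _)).
  apply: leq_trans (leq_card_setU _ _); rewrite -[leqLHS]card_ord -cardsT.
  apply/subset_leq_card/fintype.subsetP => j _; rewrite !inE.
  by case: (kinds j) => /asboolP ->; rewrite ?orbT //=;
    case: `[< aligned 1 k _ >]; case: `[< aligned _ k _ >]; rewrite /= ?orbT.
have x0 j : x j != 0 by rewrite -inner_eq0 orth eqxx oner_neq0.
pose fam I (t : {j | j \in U I}) := x (val t).
have fam_orth I s t : s != t -> inner (@fam I s) (fam I t) = 0.
  by move=> st; rewrite orth (inj_eq val_inj) (negbTE st).
have fam_supp I t : supported I (@fam I t).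
  by have := valP t; rewrite !inE => /andP[_ /asboolP].
have cardU I : #|U I| = #|{: {j | j \in U I}}| by rewrite card_sig.
have [T0|] := eqVneq T finset.set0.
  move: cover; rewrite T0 cards0 add0n => /leq_trans; apply; rewrite !cardU.
  by apply: leq_add; apply: orthogonal_card (fam_orth _) _ (fam_supp _) => t; apply: x0.
case/finset.set0Pn => w wT.
have xw i : x w i 0 != 0.
  by move: wT; rewrite !inE => /orP[]/asboolP; apply: aligned_neq0.
have lt (I : {set 'I_n.+1}) : (0 < #|I| -> #|U I| < #|I|)%N.
  move=> /card_gt0P[i iI]; rewrite cardU.
  apply: (orthogonal_card_lt (w := x w) (@fam_orth I) _ (@fam_supp I)).
  - by move=> t; apply: x0.
  - case=> j jU; rewrite orth; case: eqP => // e.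
    by move: (jU); rewrite [j]e inE wT.
  - by exists i.
have T2 : (#|T| <= 1 + 1)%N.
  by apply: leq_trans (leq_card_setU _ _) (leq_add _ _); apply: aligned_card.
apply: leq_trans cover _.
apply: leq_trans (leq_add T2 (leqnn _)) _.
by rewrite addnACA leq_add // add1n lt.
Qed.

Lemma gau_wu_le (A : 'M[C]_n) (N : nat) :
  (forall m, (m <= n)%N -> has_boundary_family A m -> (m <= N)%N) ->
  (gau_wu A <= N)%N.
Proof.
by move=> le; apply/bigmax_leqP => m /asboolP; apply: le; rewrite -ltnS.
Qed.

(** The basis vectors of [I] form a suitable family. *)
Lemma gau_wu_ge (A : 'M[C]_n) (I : {set 'I_n}) :
  (forall i, i \in I -> boundary (numerical_range A) (A i i)) ->
  (#|I| <= gau_wu A)%N.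
Proof.
move=> bd.
have In : (#|I| < n.+1)%N by rewrite ltnS -[leqRHS]card_ord max_card.
apply: (@leq_bigmax_cond _ _ (fun m : 'I_n.+1 => m : nat) (Ordinal In)).
apply/asboolP; exists (fun j => delta_mx (enum_val j) 0); split => [i j|j].
  by rewrite inner_delta mxE eqxx andbT (inj_eq enum_val_inj) eq_sym.
by rewrite num_form_delta; apply: bd; apply: enum_valP.
Qed.

End Counting.

Theorem theorem8 (R : realType) (n : nat)
    (a : 'I_n.+1 -> R[i]) (b c : 'I_n -> R[i]) (theta : R) (lmax lmin : R[i])
    (n_ge3 : (3 <= n.+1)%N)
    (b_neq0 : forall j, b j != 0) (c_neq0 : forall j, c j != 0)
    (norm_bc : forall j, `|b j| = `|c j|)
    (arg_bc : forall j, eq_mod_2pi (arg (b j) + arg (c j)) (2 * theta + pi))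
    (lmaxP : largest_eigenvalue
               (re_mx (expi (- theta) *: arrowhead a b c)) lmax)
    (lminP : smallest_eigenvalue
               (re_mx (expi (- theta) *: arrowhead a b c)) lmin) :
  gau_wu (arrowhead a b c) =
    extremal_multiplicity
      (re_mx (expi (- theta) *: arrowhead a b c)) lmax lmin.
Proof.
set A := arrowhead a b c in lmaxP lminP *.
set mu0 := expi (- theta) in lmaxP lminP *.
have mu0_neq0 : mu0 != 0 by apply: expi_neq0.
pose b' j := mu0 * b j; pose c' j := mu0 * c j.
have AB : mu0 *: A = arrowhead (fun i => mu0 * a i) b' c'.
  apply/matrixP => i j; rewrite !mxE.
  by case: (unlift _ i) => [?|]; case: (unlift _ j) => [?|] //; case: eqP; rewrite ?mulr0.
have skew j : (c' j)^* = - b' j by apply: skew_phase.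
have b'_neq0 j : b' j != 0 by rewrite mulf_neq0.
have diagD : is_diag_mx (re_mx (mu0 *: A)) by rewrite AB; apply: re_mx_arrowhead_diag.
set D := re_mx (mu0 *: A) in lmaxP lminP diagD *.
have [[/(eigenvalue_diag _ diagD)[imax Dmax] lmax_ub]
      [/(eigenvalue_diag _ diagD)[imin Dmin] lmin_lb]] := (lmaxP, lminP).
have leDmax i : D i i <= lmax by apply/lmax_ub/eigenvalue_diag => //; exists i.
have geDmin i : lmin <= D i i by apply/lmin_lb/eigenvalue_diag => //; exists i.
pose Imax := [set i | D i i == lmax]; pose Imin := [set i | D i i == lmin].
have multD l : multiplicity D l = #|[set i | D i i == l]|.
  exact: rank_eigenspace_diag.
have card_ext : extremal_multiplicity D lmax lmin = #|Imax :|: Imin|.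
  rewrite /extremal_multiplicity !multD; case: eqP => [e|ne].
    by rewrite /Imax /Imin e finset.setUid.
  rewrite cardsU (_ : Imax :&: Imin = finset.set0) ?cards0 ?subn0 //.
  by apply/finset.setP => i; rewrite !inE; apply/negP => /andP[/eqP-> /eqP].
have form_re y : (complex.Re (mu0 * num_form A y))%:C = num_form D y.
  by rewrite num_form_re_mx /num_form -scalemxAl innerZl.
have formD y : num_form D y = \sum_i D i i * (y i 0 * (y i 0)^*).
  apply: eq_bigr => i _; rewrite mxE (bigD1 i) //= big1 ?addr0 ?mulrA //.
  by move=> j ji; move/is_diag_mxP: diagD => ->; rewrite ?mul0r // eq_sym.
have form_le y : inner y y = 1 -> num_form D y <= lmax.
  move=> y1; rewrite formD -[lmax]mulr1 -y1 /inner mulr_sumr; apply: ler_sum => i _.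
  by rewrite ler_wpM2r // -normCK exprn_ge0.
have form_ge y : inner y y = 1 -> lmin <= num_form D y.
  move=> y1; rewrite formD -[lmin]mulr1 -y1 /inner mulr_sumr; apply: ler_sum => i _.
  by rewrite ler_wpM2r // -normCK exprn_ge0.
apply/eqP; rewrite eqn_leq card_ext; apply/andP; split; last first.
  apply: gau_wu_ge => i; rewrite -num_form_delta => iI.
  have e1 : inner (delta_mx i 0 : 'cV[R[i]]_n.+1) (delta_mx i 0) = 1.
    by rewrite inner_delta mxE !eqxx.
  move: iI; rewrite !inE => /orP[]/eqP Di.
    apply: (maximizer_boundary mu0_neq0) => // y y1.
    by rewrite -lecR !form_re [leRHS]num_form_delta Di form_le.
  apply: (@maximizer_boundary _ _ _ _ (- mu0)) => [||y y1] //; first by rewrite oppr_eq0.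
  by rewrite !mulNr !raddfN /= lerN2 -lecR !form_re num_form_delta Di form_ge.
apply: gau_wu_le => m mn [x [orth bd]].
have [e|ne] := eqVneq lmax lmin.
  suff -> : Imax :|: Imin = [set: 'I_n.+1] by rewrite cardsT card_ord.
  apply/finset.setP => i; rewrite !inE; apply/orP; left.
  by rewrite eq_le leDmax e geDmin.
move: card_ext; rewrite /extremal_multiplicity (negbTE ne) !multD => <-.
apply: (@orthonormal_card_le _ _ _ x _ _ (fun j => (0 +i* 1) * b' j)) => //.
- by move=> j; rewrite mulf_neq0 // eq_complex /= oner_eq0 andbF.
- by apply/card_gt0P; exists imax; rewrite inE Dmax.
- by apply/card_gt0P; exists imin; rewrite inE Dmin.
move=> j; have xj1 : inner (x j) (x j) = 1 by rewrite orth eqxx.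
have [mu [l]] := boundary_eigenvector xj1 (bd j).
(* the direction of the normal is measured from that of [D] *)
have -> : mu *: A = (mu / mu0) *: (mu0 *: A) by rewrite scalerA divfK.
rewrite AB => -[mu_neq0 Px Ph Ppos].
have [||top|bot|al|al] := skew_arrowhead_extremal skew b'_neq0 _ _ Px Ph Ppos.
- by rewrite mulf_neq0 // invr_eq0.
- by rewrite -inner_eq0 xj1 oner_neq0.
- apply: Or41 => i xi; rewrite inE eq_le leDmax /=.
  by rewrite -Dmax /D AB; apply: top.
- apply: Or42 => i xi; rewrite inE eq_le geDmin andbT.
  by rewrite -Dmin /D AB; apply: bot.
- exact: Or43.
- exact: Or44.
Qed.
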